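(* For all $f,g\in C[0,1]$ and all $x\in[0,1]$, $$|T(f,g;x)|\le\frac14\cdot osc_{V_1^*}(f)\cdot osc_{V_1^*}(g)=\frac14\cdot|f(0)-f(1)|\cdot|g(0)-g(1)|.$$
   Context: $V_1^*:C[0,1]\to C[0,1]$ is the King-type operator for $n=1$, $V_1^*(f;x)=(1-r_1^*(x))f(0)+r_1^*(x)f(1)$ with $r_1^*(x)=x^2$. $T(f,g;x):=V_1^*(fg;x)-V_1^*(f;x)V_1^*(g;x)$, and $osc_{V_1^*}(f):=|f(0)-f(1)|$ is the oscillation of $f$ over the nodes $0,1$; similarly for $g$. *)

(* Defs.v *)
From mathcomp Require Import all_boot all_order all_algebra.
From mathcomp Require Import all_classical all_reals topology normedtype.

Set Implicit Arguments.
Unset Strict Implicit.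
Unset Printing Implicit Defensive.

Import Order.TTheory GRing.Theory Num.Theory.
Import numFieldNormedType.Exports.

Local Open Scope ring_scope.

(* An element of C[0,1] is represented by a total function R -> R continuous
   within `[0, 1]; the definitions below only use its values at 0 and 1. *)

Definition king_r1 (R : realType) (x : R) : R := x ^+ 2.

Definition king_V1 (R : realType) (f : R -> R) (x : R) : R :=
  (1 - king_r1 x) * f 0 + king_r1 x * f 1.

(* The Chebyshev-Grüss functional T(f,g;x) associated with V_1^*. *)
Definition king_T (R : realType) (f g : R -> R) (x : R) : R :=
  king_V1 (fun t => f t * g t) x - king_V1 f x * king_V1 g x.

(* The oscillation of f over the nodes 0 and 1 of V_1^*. *)
Definition osc_V1 (R : realType) (f : R -> R) : R := `|f 0 - f 1|.

(* Main.v *)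
(* The values of f and g at the two nodes carry the weights 1 - r and r, with
   r = x^2, so T(f,g;x) is the covariance of two functions of a Bernoulli(r)
   variable: r (1 - r) (f 0 - f 1) (g 0 - g 1). *)
Require Import Defs.
From mathcomp Require Import all_boot all_order all_algebra.
From mathcomp Require Import all_classical all_reals topology normedtype.
From mathcomp Require Import ring lra.

Import Order.TTheory GRing.Theory Num.Theory.
Import numFieldNormedType.Exports.

Local Open Scope classical_set_scope.
Local Open Scope ring_scope.

Lemma king_TE (R : realType) (f g : R -> R) (x : R) :
  king_T f g x = king_r1 x * (1 - king_r1 x) * ((f 0 - f 1) * (g 0 - g 1)).
Proof. rewrite /king_T /king_V1; ring. Qed.

(** The gap [1 / 4 - r * (1 - r)] is the square of [r - 1 / 2]. *)
Lemma mulr_onem_le_quarter (R : realFieldType) (r : R) : r * (1 - r) <= 1 / 4.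
Proof. have := sqr_ge0 (r - 1 / 2); nra. Qed.

Theorem theorem9p8 (R : realType) (f g : R -> R)
    (hf : {within `[0, 1], continuous f})
    (hg : {within `[0, 1], continuous g})
    (x : R) (hx : x \in `[0, 1]) :
  `|king_T f g x| <= 1 / 4 * osc_V1 f * osc_V1 g /\
  1 / 4 * osc_V1 f * osc_V1 g = 1 / 4 * `|f 0 - f 1| * `|g 0 - g 1|.
Proof.
split=> //; move: hx; rewrite in_itv /= => /andP[x_ge0 x_le1].
(* Both weights [king_r1 x] and [1 - king_r1 x] are nonnegative on the unit interval, so their
   absolute values will drop. *)
have r_ge0 : 0 <= king_r1 x by exact: sqr_ge0.
have r_le1 : king_r1 x <= 1 by exact: exprn_ile1.
(* Reassociating the right side exposes the product of the two oscillations as a common nonnegative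
   factor; only the variance bound on the weights remains. *)
rewrite king_TE !normrM ger0_norm // ger0_norm ?subr_ge0 // /osc_V1 -[leRHS]mulrA.
by rewrite ler_wpM2r ?mulr_ge0 // mulr_onem_le_quarter.
Qed.
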